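(* The 2-category $\mathbf{Sup}$ of complete lattices and join-preserving maps is homologically self-dual, and its normal 2-monomorphisms and its normal 2-epimorphisms are closed under composition; but it does not satisfy condition (DPN).
   Context: $\mathbf{Sup}$ is the 2-category whose objects are the complete lattices (small with respect to a fixed Grothendieck universe), whose 1-cells are the maps preserving all joins (including the empty one, so $\bot\mapsto\bot$), and in which there is exactly one 2-cell $f\Rightarrow g$ when $f\le g$ pointwise and none otherwise. Its strong bizero object is the one-element lattice. A bizero object of a 2-category $\mathcal L$ is an object $0$ such that for every object $A$ the hom-categories $\mathcal L(A,0)$ and $\mathcal L(0,A)$ are equivalent to the terminal category. A 1-cell is null if it factors through $0$; $f\cong 0$ means that $f$ is isomorphic (via an invertible 2-cell) to a null 1-cell. The bizero object is strong if between any two parallel 1-cells that factor through $0$ there is exactly one 2-cell. In a 2-category with a strong bizero object, a 2-kernel of $f\colon A\to B$ is a 1-cell $k\colon K\to A$ with an invertible 2-cell $f\circ k\cong 0$ such that (1) for every $z\colon Z\to A$ with $f\circ z\cong0$ there is $u\colon Z\to K$ with $k\circ u\cong z$; (2) for all $u,v\colon Z\to K$ and every 2-cell $\lambda\colon k\circ u\Rightarrow k\circ v$ there is a unique 2-cell $\mu\colon u\Rightarrow v$ whose whiskering with $k$ is $\lambda$. 2-cokernels are defined dually. They are written $\ker(f)\colon\mathrm{Ker}(f)\to A$, $\operatorname{coker}(f)\colon B\to\mathrm{Cok}(f)$. A 2-category with a strong bizero object is 2-z-exact if it has all 2-kernels and 2-cokernels. A normal 2-monomorphism is a 1-cell which is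 a 2-kernel of some 1-cell; a normal 2-epimorphism is a 1-cell which is a 2-cokernel of some 1-cell. A 1-cell is normal if it is isomorphic to $m\circ e$ with $e$ a normal 2-epimorphism and $m$ a normal 2-monomorphism. An antinormal pair $(m,e)$ consists of a normal 2-monomorphism $m\colon K\to X$ and a normal 2-epimorphism $e\colon X\to R$; its dinversion is $\operatorname{coker}(m)\circ\ker(e)\colon\mathrm{Ker}(e)\to\mathrm{Cok}(m)$. A 2-z-exact 2-category is homologically self-dual if the dinversion of every antinormal pair $(m,e)$ with $e\circ m\cong0$ is normal. It satisfies (DPN) if for every antinormal pair $(m,e)$ the composite $e\circ m$ is normal if and only if the dinversion $\operatorname{coker}(m)\circ\ker(e)$ is normal. *)

(* Defs.v *)
From HB Require Import structures.
From mathcomp Require Import all_boot all_order.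
From mathcomp Require Import boolp classical_sets.
Set Implicit Arguments.
Unset Strict Implicit.
Unset Printing Implicit Defensive.
Local Open Scope classical_set_scope.

Record category := Category {
  cobj :> Type;
  mor : cobj -> cobj -> Type;
  idm : forall x, mor x x;
  compm : forall x y z, mor y z -> mor x y -> mor x z;
  compm1 : forall x y (a : mor x y), compm a (idm x) = a;
  comp1m : forall x y (a : mor x y), compm (idm y) a = a;
  compmA : forall x y z t (c : mor z t) (b : mor y z) (a : mor x y),
    compm c (compm b a) = compm (compm c b) a }.
Arguments mor {_} _ _.
Arguments idm {_} _.

Record functor (C D : category) := Functor {
  fobj :> C -> D;
  fmap : forall x y : C, mor x y -> mor (fobj x) (fobj y);
  fmap1 : forall x, fmap (idm x) = idm (fobj x);
  fmapM : forall (x y z : C) (b : mor y z) (a : mor x y),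
    fmap (compm b a) = compm (fmap b) (fmap a) }.
Arguments fmap {_ _} _ {_ _}.

Definition invertible (C : category) (x y : C) (a : mor x y) : Prop :=
  exists b : mor y x, compm b a = idm x /\ compm a b = idm y.

Definition isomorphic (C : category) (x y : C) : Prop :=
  exists a : mor x y, invertible a.
Notation "x ~= y" := (isomorphic x y) (at level 70, no associativity).

Definition naturally_isomorphic (C D : category) (F G : functor C D) : Prop :=
  exists eta : forall x : C, mor (F x) (G x),
    (forall x, invertible (eta x)) /\
    (forall (x y : C) (a : mor x y),
       compm (eta y) (fmap F a) = compm (fmap G a) (eta x)).

Definition fid (C : category) : functor C C :=
  @Functor C C id (fun x y => id) (fun x => erefl) (fun x y z b a => erefl).

Lemma fcomp1_subproof (C D E : category) (G : functor D E) (F : functor C D)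
  (x : C) : fmap G (fmap F (idm x)) = idm (G (F x)).
Proof. by rewrite !fmap1. Qed.

Lemma fcompM_subproof (C D E : category) (G : functor D E) (F : functor C D)
  (x y z : C) (b : mor y z) (a : mor x y) :
  fmap G (fmap F (compm b a)) = compm (fmap G (fmap F b)) (fmap G (fmap F a)).
Proof. by rewrite !fmapM. Qed.

Definition fcomp (C D E : category) (G : functor D E) (F : functor C D) :
    functor C E :=
  @Functor C E (fun x => G (F x)) (fun x y a => fmap G (fmap F a))
    (fcomp1_subproof G F) (fcompM_subproof G F).

Definition equivalent (C D : category) : Prop :=
  exists (F : functor C D) (G : functor D C),
    naturally_isomorphic (fcomp G F) (fid C) /\
    naturally_isomorphic (fcomp F G) (fid D).

Lemma terminal1_subproof (x y : unit) (a : unit) : tt = a.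
Proof. by case: a. Qed.

Definition terminal_category : category :=
  @Category unit (fun _ _ => unit) (fun _ => tt) (fun _ _ _ _ _ => tt)
    terminal1_subproof terminal1_subproof (fun _ _ _ _ _ _ _ => erefl).

Section Products.
Variables C D : category.

Definition prod_mor (x y : C * D) : Type := (mor x.1 y.1 * mor x.2 y.2)%type.
Definition prod_idm (x : C * D) : prod_mor x x := (idm x.1, idm x.2).
Definition prod_compm (x y z : C * D) (b : prod_mor y z) (a : prod_mor x y) :
  prod_mor x z := (compm b.1 a.1, compm b.2 a.2).

Lemma prod_compm1 x y (a : prod_mor x y) : prod_compm a (prod_idm x) = a.
Proof. by case: a => a b; rewrite /prod_compm /= !compm1. Qed.

Lemma prod_comp1m x y (a : prod_mor x y) : prod_compm (prod_idm y) a = a.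
Proof. by case: a => a b; rewrite /prod_compm /= !comp1m. Qed.

Lemma prod_compmA x y z t (c : prod_mor z t) (b : prod_mor y z)
  (a : prod_mor x y) :
  prod_compm c (prod_compm b a) = prod_compm (prod_compm c b) a.
Proof. by rewrite /prod_compm /= !compmA. Qed.

Definition prodcat : category :=
  @Category (C * D)%type prod_mor prod_idm prod_compm
    prod_compm1 prod_comp1m prod_compmA.

Definition ffst : functor prodcat C :=
  @Functor prodcat C fst (fun x y => fst) (fun x => erefl)
    (fun x y z b a => erefl).

Definition fsnd : functor prodcat D :=
  @Functor prodcat D snd (fun x y => snd) (fun x => erefl)
    (fun x y z b a => erefl).

Lemma fpair1_subproof (E : category) (F : functor E C) (G : functor E D) x :
  (fmap F (idm x), fmap G (idm x)) = prod_idm (F x, G x).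
Proof. by rewrite !fmap1. Qed.

Lemma fpairM_subproof (E : category) (F : functor E C) (G : functor E D)
  (x y z : E) (b : mor y z) (a : mor x y) :
  (fmap F (compm b a), fmap G (compm b a)) =
  @prod_compm (F x, G x) (F y, G y) (F z, G z)
    (fmap F b, fmap G b) (fmap F a, fmap G a).
Proof. by rewrite !fmapM. Qed.

Definition fpair (E : category) (F : functor E C) (G : functor E D) :
    functor E prodcat :=
  @Functor E prodcat (fun x => (F x, G x)) (fun x y a => (fmap F a, fmap G a))
    (fpair1_subproof F G) (fpairM_subproof F G).

Definition fconst (y : D) : functor C D :=
  @Functor C D (fun _ => y) (fun _ _ _ => idm y) (fun _ => erefl)
    (fun _ _ _ _ _ => esym (compm1 (idm y))).

End Products.

Definition fprod (C C' D D' : category) (F : functor C C') (G : functor D D') :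
    functor (prodcat C D) (prodcat C' D') :=
  fpair (fcomp F (ffst C D)) (fcomp G (fsnd C D)).

Definition fassoc (C D E : category) :
    functor (prodcat (prodcat C D) E) (prodcat C (prodcat D E)) :=
  fpair (fcomp (ffst C D) (ffst (prodcat C D) E))
        (fprod (fsnd C D) (fid E)).

(* A (strict) 2-category, as a category enriched in categories: the equations
   between functors express associativity and unitality of both 1-cells and
   2-cells, and functoriality of [hcomp] is the interchange law. *)
Record twocat := TwoCat {
  ob : Type;
  hom : ob -> ob -> category;
  one : forall A, hom A A;
  hcomp : forall A B C, functor (prodcat (hom B C) (hom A B)) (hom A C);
  hcompA : forall A B C D,
    fcomp (hcomp A B D) (fprod (hcomp B C D) (fid (hom A B))) =
    fcomp (fcomp (hcomp A C D) (fprod (fid (hom C D)) (hcomp A B C)))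
          (fassoc (hom C D) (hom B C) (hom A B));
  hcomp1l : forall A B,
    fcomp (hcomp A B B) (fpair (fconst (hom A B) (one B)) (fid (hom A B))) =
    fid (hom A B);
  hcomp1r : forall A B,
    fcomp (hcomp A A B) (fpair (fid (hom A B)) (fconst (hom A B) (one A))) =
    fid (hom A B) }.
Arguments hom {_} _ _.
Arguments hcomp {_} _ _ _.

Section TwoCategoryTheory.
Variable L : twocat.

Definition comp1 (A B C : ob L) (g : hom B C) (f : hom A B) : hom A C :=
  hcomp A B C (g, f).
Local Notation "g \; f" := (comp1 g f).

Definition whiskerl (A B C : ob L) (k : hom B C) (u v : hom A B)
    (mu : mor u v) : mor (k \; u) (k \; v) :=
  fmap (hcomp A B C) ((idm k, mu) : @mor (prodcat _ _) (k, u) (k, v)).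

Definition whiskerr (A B C : ob L) (u v : hom B C) (q : hom A B)
    (mu : mor u v) : mor (u \; q) (v \; q) :=
  fmap (hcomp A B C) ((mu, idm q) : @mor (prodcat _ _) (u, q) (v, q)).

Definition bizero (Z : ob L) : Prop :=
  forall A : ob L, equivalent (hom A Z) terminal_category /\
                   equivalent (hom Z A) terminal_category.

Definition null_through (Z A B : ob L) (f : hom A B) : Prop :=
  exists (g : hom A Z) (h : hom Z B), f = h \; g.

Definition strong_bizero (Z : ob L) : Prop :=
  bizero Z /\
  forall (A B : ob L) (f g : hom A B),
    null_through Z f -> null_through Z g -> exists! a : mor f g, True.

Section WithZero.
Variable Z : ob L.

Definition iso_null (A B : ob L) (f : hom A B) : Prop :=
  exists n : hom A B, null_through Z n /\ f ~= n.

Definition is_kernel (A B K : ob L) (f : hom A B) (k : hom K A) : Prop :=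
  [/\ iso_null (f \; k),
      forall (X : ob L) (z : hom X A), iso_null (f \; z) ->
        exists u : hom X K, k \; u ~= z
    & forall (X : ob L) (u v : hom X K) (lam : mor (k \; u) (k \; v)),
        exists! mu : mor u v, whiskerl k mu = lam].

Definition is_cokernel (A B Q : ob L) (f : hom A B) (q : hom B Q) : Prop :=
  [/\ iso_null (q \; f),
      forall (X : ob L) (z : hom B X), iso_null (z \; f) ->
        exists u : hom Q X, u \; q ~= z
    & forall (X : ob L) (u v : hom Q X) (lam : mor (u \; q) (v \; q)),
        exists! mu : mor u v, whiskerr q mu = lam].

Definition z_exact : Prop :=
  [/\ strong_bizero Z,
      forall (A B : ob L) (f : hom A B),
        exists (K : ob L) (k : hom K A), is_kernel f k
    & forall (A B : ob L) (f : hom A B),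
        exists (Q : ob L) (q : hom B Q), is_cokernel f q].

Definition normal_mono (K A : ob L) (m : hom K A) : Prop :=
  exists (B : ob L) (f : hom A B), is_kernel f m.

Definition normal_epi (B Q : ob L) (e : hom B Q) : Prop :=
  exists (A : ob L) (f : hom A B), is_cokernel f e.

Definition normal (A B : ob L) (f : hom A B) : Prop :=
  exists (I : ob L) (e : hom A I) (m : hom I B),
    [/\ normal_epi e, normal_mono m & f ~= m \; e].

Definition antinormal_pair (K X R : ob L) (m : hom K X) (e : hom X R) : Prop :=
  normal_mono m /\ normal_epi e.

(* Kernels and cokernels, hence dinversions, are determined only up to
   equivalence, so "the" dinversion is rendered as a relation; conditions on it
   are imposed on all of its representatives. *)
Definition is_dinversion (K X R : ob L) (m : hom K X) (e : hom X R)
    (M Q : ob L) (d : hom M Q) : Prop :=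
  exists (k : hom M X) (c : hom X Q),
    [/\ is_kernel e k, is_cokernel m c & d = c \; k].

Definition homologically_self_dual : Prop :=
  z_exact /\
  forall (K X R : ob L) (m : hom K X) (e : hom X R),
    antinormal_pair m e -> iso_null (e \; m) ->
    forall (M Q : ob L) (d : hom M Q), is_dinversion m e d -> normal d.

Definition DPN : Prop :=
  forall (K X R : ob L) (m : hom K X) (e : hom X R), antinormal_pair m e ->
    forall (M Q : ob L) (d : hom M Q), is_dinversion m e d ->
      (normal (e \; m) <-> normal d).

Definition normal_monos_closed : Prop :=
  forall (A B C : ob L) (m : hom A B) (n : hom B C),
    normal_mono m -> normal_mono n -> normal_mono (n \; m).

Definition normal_epis_closed : Prop :=
  forall (A B C : ob L) (e : hom A B) (p : hom B C),
    normal_epi e -> normal_epi p -> normal_epi (p \; e).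

End WithZero.
End TwoCategoryTheory.
Arguments homologically_self_dual : clear implicits.
Arguments DPN : clear implicits.
Arguments normal_monos_closed : clear implicits.
Arguments normal_epis_closed : clear implicits.

(* Sets are predicates, so completeness quantifies over all subsets of the
   carrier, including the empty one. The decidable equality, boolean order and
   choice operator that a [porderType] carries exist classically on every poset.
   Smallness is membership in the universe of carriers of [porderType]. *)
Record completeLattice := CompleteLattice {
  cl_disp : Order.disp_t;
  cl_sort :> porderType cl_disp;
  cl_complete : forall S : set cl_sort, exists s, isLub S s }.

Record supmap (A B : completeLattice) := SupMap {
  supmap_fun :> A -> B;
  supmap_lub : forall (S : set A) (s : A),
    isLub S s -> isLub (supmap_fun @` S) (supmap_fun s) }.

Lemma supmap_eq (A B : completeLattice) (f g : supmap A B) :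
  (forall x, f x = g x) -> f = g.
Proof.
case: f g => f fP [g gP] /= /funext fg; move: fP gP; rewrite fg => fP gP.
by rewrite (Prop_irrelevance fP gP).
Qed.

Lemma supid_subproof (A : completeLattice) (S : set A) (s : A) :
  isLub S s -> isLub (id @` S) (id s).
Proof. by rewrite image_id. Qed.

Definition supid (A : completeLattice) : supmap A A :=
  SupMap (@supid_subproof A).

Lemma supcomp_subproof (A B C : completeLattice) (g : supmap B C)
  (f : supmap A B) (S : set A) (s : A) :
  isLub S s -> isLub ((g \o f) @` S) ((g \o f) s).
Proof. by move=> /(supmap_lub f)/(supmap_lub g); rewrite image_comp. Qed.

Definition supcomp (A B C : completeLattice) (g : supmap B C)
    (f : supmap A B) : supmap A C :=
  SupMap (supcomp_subproof g f).

Definition supmap_le (A B : completeLattice) (f g : supmap A B) : Prop :=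
  forall x, (f x <= g x)%O.

Lemma supmap_le_refl (A B : completeLattice) (f : supmap A B) : supmap_le f f.
Proof. by move=> x; exact: Order.POrderTheory.lexx. Qed.

Lemma supmap_le_trans (A B : completeLattice) (f g h : supmap A B) :
  supmap_le g h -> supmap_le f g -> supmap_le f h.
Proof. by move=> gh fg x; exact: Order.POrderTheory.le_trans (fg x) (gh x). Qed.

Definition suphom (A B : completeLattice) : category :=
  @Category (supmap A B) (@supmap_le A B) (@supmap_le_refl A B)
    (@supmap_le_trans A B)
    (fun f g a => Prop_irrelevance _ a) (fun f g a => Prop_irrelevance _ a)
    (fun f g h k c b a => Prop_irrelevance _ _).

Lemma supmap_mono (A B : completeLattice) (f : supmap A B) (x y : A) :
  (x <= y)%O -> (f x <= f y)%O.
Proof.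
move=> xy; have lub : isLub [set x; y] y.
  split=> [z [->|->] //|b].
  by apply; right.
by have [+ _] := supmap_lub f lub; apply; exists x => //; left.
Qed.

Lemma suphcomp_subproof (A B C : completeLattice)
  (x y : prodcat (suphom B C) (suphom A B)) :
  mor x y -> supmap_le (supcomp x.1 x.2) (supcomp y.1 y.2).
Proof.
case: x y => [g f] [g' f'] [/= gg' ff'] z /=.
exact: Order.POrderTheory.le_trans (supmap_mono g (ff' z)) (gg' _).
Qed.

Definition suphcomp (A B C : completeLattice) :
    functor (prodcat (suphom B C) (suphom A B)) (suphom A C) :=
  @Functor (prodcat (suphom B C) (suphom A B)) (suphom A C)
    (fun x => supcomp x.1 x.2) (@suphcomp_subproof A B C)
    (fun x => @Prop_irrelevance (supmap_le _ _) _ _)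
    (fun x y z b a => @Prop_irrelevance (supmap_le _ _) _ _).

Lemma suphom_functor_eq (C : category) (A B : completeLattice)
  (F G : functor C (suphom A B)) : (forall x, F x = G x) -> F = G.
Proof.
case: F G => [F Fm F1 FM] [G Gm G1 GM] /= FG.
have {}FG : F = G by exact/funext.
subst G.
have E : Fm = Gm.
  apply: functional_extensionality_dep => x.
  apply: functional_extensionality_dep => y.
  by apply: functional_extensionality_dep => a; exact: (@Prop_irrelevance (supmap_le _ _)).
subst Gm.
by rewrite (Prop_irrelevance F1 G1) (Prop_irrelevance FM GM).
Qed.

Lemma suphcompA (A B C D : completeLattice) :
  fcomp (suphcomp A B D) (fprod (suphcomp B C D) (fid (suphom A B))) =
  fcomp (fcomp (suphcomp A C D) (fprod (fid (suphom C D)) (suphcomp A B C)))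
        (fassoc (suphom C D) (suphom B C) (suphom A B)).
Proof. by apply: suphom_functor_eq => x; exact: supmap_eq. Qed.

Lemma suphcomp1l (A B : completeLattice) :
  fcomp (suphcomp A B B)
        (fpair (@fconst (suphom A B) (suphom B B) (supid B))
               (fid (suphom A B))) =
  fid (suphom A B).
Proof. by apply: suphom_functor_eq => x; exact: supmap_eq. Qed.

Lemma suphcomp1r (A B : completeLattice) :
  fcomp (suphcomp A A B)
        (fpair (fid (suphom A B))
               (@fconst (suphom A B) (suphom A A) (supid A))) =
  fid (suphom A B).
Proof. by apply: suphom_functor_eq => x; exact: supmap_eq. Qed.

Definition Sup : twocat :=
  @TwoCat completeLattice suphom supid suphcomp
    suphcompA suphcomp1l suphcomp1r.

Lemma one_lattice_complete (S : set 'I_1) : exists s, isLub S s.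
Proof. by exists ord0; split=> x _; rewrite ?(ord1 x). Qed.

Definition one_lattice : completeLattice :=
  CompleteLattice one_lattice_complete.

(* Main.v *)
From HB Require Import structures.
From mathcomp Require Import all_boot all_order.
From mathcomp Require Import boolp classical_sets.
Require Import Defs.
Set Implicit Arguments.
Unset Strict Implicit.
Unset Printing Implicit Defensive.
Import Order.POrderTheory.
Local Open Scope classical_set_scope.
Local Open Scope order_scope.

(** Both 2-dimensional conditions collapse in [Sup]: hom-categories are posets,
    so isomorphic 1-cells are equal, and a map is null exactly when it sends
    everything to the bottom element. The argument is then pure lattice theory.

    The kernel of [f] is the principal ideal of the elements killed by [f], and
    the cokernel of [f] is the map [x |-> x \/ f(1)] onto the principal filter
    above [f(1)]. Intrinsically ([is_kernelP], [is_cokernelP]), a kernel is an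
    order embedding whose image is the null ideal, and a cokernel is a
    surjection [q] such that [q x <= q y] if and only if [x <= y \/ f(1)].
    Hence ([normal_monoP], [normal_epiP], [normalP])
    - a normal 2-monomorphism is an order embedding with down-closed image;
    - a normal 2-epimorphism is a surjection [e] for which there is some [b]
      with [e x <= e y] if and only if [x <= y \/ b];
    - [f] is normal if and only if its image is down-closed and there is some
      [a] with [f x <= f y] if and only if [x <= y \/ a].

    Closure under composition is immediate from the first two descriptions. If
    [m] and [e] form an antinormal pair with [e m] null, then [m(1)] lies in the
    kernel [k] of [e], say [m(1) = k a]; so with [c] the cokernel of [m], the
    relation [c x <= c (k y)] means [x <= k (y \/ a)], which gives both
    conditions for [c k] to be normal.

    For the failure of (DPN), consider the pentagon, with [low < high] and
    [side] a complement of both, and compose the inclusion of the ideal below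
    [high] with the projection onto the filter above [side]. The dinversion is an isomorphism between two-element lattices, but
    the composite identifies [low] with [high] while killing only the bottom
    element, so that it is not normal. *)

(** * Suprema in a complete lattice *)

Section Suprema.
Variable A : completeLattice.
Implicit Types (S : set A) (x y z : A).

Definition lub S : A := projT1 (cid (cl_complete S)).

Lemma lubP S : isLub S (lub S).
Proof. exact: projT2 (cid (cl_complete S)). Qed.

Lemma le_lub S x : S x -> x <= lub S.
Proof. by move=> Sx; have [+ _] := lubP S; apply. Qed.

Lemma lub_le S y : (forall x, S x -> x <= y) -> lub S <= y.
Proof. by move=> Sy; have [_ +] := lubP S; apply. Qed.

Lemma isLub_eq S x : isLub S x -> x = lub S.
Proof.
move=> [ubx lex]; apply/le_anti/andP; split; first exact: lex (lubP S).1.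
exact: (lubP S).2.
Qed.

Definition bot : A := lub set0.
Definition top : A := lub setT.
Definition join x y : A := lub [set x; y].

Lemma bot_le x : bot <= x. Proof. exact: lub_le. Qed.
Lemma le_top x : x <= top. Proof. exact: le_lub. Qed.

Lemma le_bot x : x <= bot -> x = bot.
Proof. by move=> xb; apply/le_anti; rewrite xb bot_le. Qed.

Lemma join_le x y z : (join x y <= z) = (x <= z) && (y <= z).
Proof.
apply/idP/andP => [xyz|[xz yz]]; last by apply: lub_le => t [->|->].
by split; apply: le_trans xyz; apply: le_lub; [left|right].
Qed.

Lemma le_joinl x y : x <= join x y.
Proof. by have := lexx (join x y); rewrite join_le => /andP[]. Qed.

Lemma le_joinr x y : y <= join x y.
Proof. by have := lexx (join x y); rewrite join_le => /andP[]. Qed.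

Lemma join_bot x : join x bot = x.
Proof. by apply/le_anti; rewrite le_joinl join_le lexx bot_le. Qed.

Lemma bot_join x : join bot x = x.
Proof. by apply/le_anti; rewrite le_joinr join_le lexx bot_le. Qed.

Lemma joinA x y z : join x (join y z) = join (join x y) z.
Proof.
have joinE t : (join x (join y z) <= t) = (join (join x y) z <= t).
  by rewrite !join_le andbA.
by apply/le_anti; rewrite joinE lexx -joinE lexx.
Qed.

End Suprema.
Arguments bot {A}.
Arguments top {A}.

Lemma supmap_bot (A B : completeLattice) (f : supmap A B) : f bot = bot.
Proof.
have := supmap_lub f (lubP (set0 : set A)).
by rewrite image_set0 => /isLub_eq.
Qed.

Lemma supmap_join (A B : completeLattice) (f : supmap A B) (x y : A) :
  f (join x y) = join (f x) (f y).
Proof.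
have := supmap_lub f (lubP [set x; y]).
by rewrite image_setU !image_set1 => /isLub_eq.
Qed.

(** * Principal ideals and filters *)

Section Segment.
Variables (A : completeLattice) (a b : A).

(** The interval from [a] to [b], with the induced order. Principal ideals and
    principal filters are the intervals starting at the bottom and ending at the
    top. *)
Record segment :=
  Segment { segment_val :> A; segmentP : a <= segment_val <= b }.
HB.instance Definition _ := [isSub for segment_val].
HB.instance Definition _ := [Choice of segment by <:].
HB.instance Definition _ :=
  [SubChoice_isSubPOrder of segment by <: with cl_disp A].

Hypothesis ab : a <= b.

Lemma segment_complete (S : set segment) : exists s, isLub S s.
Proof.
(* The join with [a] is there for empty [S], whose supremum in [A] may lie
   below [a]. *)
have tP : a <= join a (lub (segment_val @` S)) <= b.
  rewrite le_joinl join_le ab; apply: lub_le => _ [x Sx <-].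
  by case/andP: (segmentP x).
exists (Segment tP); split=> [x Sx|y Sy].
  rewrite -Order.le_val; apply: le_trans (le_joinr _ _).
  by apply: le_lub; exists x.
rewrite -Order.le_val join_le; case/andP: (segmentP y) => -> _ /=.
by apply: lub_le => _ [x Sx <-]; have := Sy x Sx; rewrite -Order.le_val.
Qed.

Definition segment_lattice : completeLattice :=
  CompleteLattice segment_complete.

End Segment.

Section IdealFilter.
Variables (A : completeLattice) (a : A).

(** The principal ideal of the elements below [a]. *)
Definition ideal : completeLattice := segment_lattice (bot_le a).

(** The principal filter of the elements above [a]. *)
Definition filter : completeLattice := segment_lattice (le_top a).

Lemma ideal_leE (x y : ideal) : (x <= y) = (segment_val x <= segment_val y).
Proof. by []. Qed.

Lemma filter_leE (x y : filter) : (x <= y) = (segment_val x <= segment_val y).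
Proof. by []. Qed.

Lemma ideal_val_lub (S : set ideal) (s : ideal) :
  isLub S s -> isLub ((fun x : ideal => segment_val x) @` S) (segment_val s).
Proof.
move=> [ubs les]; split=> [_ [x Sx <-]|t tS].
  by have := ubs x Sx; rewrite ideal_leE.
have lP : bot <= lub ((fun x : ideal => segment_val x) @` S) <= a.
  rewrite bot_le; apply: lub_le => _ [x Sx <-].
  by case/andP: (segmentP x).
apply: (@le_trans _ _ (lub ((fun x : ideal => segment_val x) @` S))).
  have := les (Segment lP); rewrite ideal_leE; apply=> x Sx.
  by rewrite ideal_leE; apply: le_lub; exists x.
by apply: lub_le => x; exact: tS.
Qed.

(** The inclusion of the ideal below [a]. *)
Definition ideal_incl : supmap ideal A := SupMap ideal_val_lub.

Lemma filter_proj_subproof (x : A) : a <= join a x <= top.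
Proof. by rewrite le_joinl le_top. Qed.

Lemma filter_proj_lub (S : set A) (s : A) : isLub S s ->
  isLub ((fun x => Segment (filter_proj_subproof x) : filter) @` S)
    (Segment (filter_proj_subproof s)).
Proof.
move=> [ubs les]; split=> [_ [x Sx <-]|t tS].
  rewrite filter_leE join_le le_joinl.
  exact: le_trans (ubs x Sx) (le_joinr _ _).
rewrite filter_leE join_le; case/andP: (segmentP t) => -> _ /=.
apply: les => x Sx; apply: le_trans (le_joinr a x) _.
by have := tS _ (ex_intro2 _ _ x Sx erefl); rewrite filter_leE.
Qed.

(** The join with [a], as a map onto the filter above [a]. *)
Definition filter_proj : supmap A filter := SupMap filter_proj_lub.

Lemma ideal_incl_le (x y : ideal) :
  (ideal_incl x <= ideal_incl y) = (x <= y).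
Proof. by rewrite ideal_leE. Qed.

Lemma ideal_inclP (x : A) : x <= a <-> exists u, ideal_incl u = x.
Proof.
split=> [xa|[u <-]]; last by case/andP: (segmentP u).
have xP : bot <= x <= a by rewrite bot_le.
by exists (Segment xP).
Qed.

Lemma filter_proj_le (x y : A) :
  (filter_proj x <= filter_proj y) = (x <= join y a).
Proof.
rewrite filter_leE /= join_le le_joinl /=.
by apply: (sameP idP); apply: (iffP idP) => /le_trans; apply;
  rewrite join_le le_joinl le_joinr.
Qed.

Lemma filter_proj_surj (y : filter) : exists x, filter_proj x = y.
Proof.
exists (segment_val y); apply: val_inj; apply/le_anti => /=.
by rewrite le_joinr join_le lexx; case/andP: (segmentP y) => ->.
Qed.

End IdealFilter.

(** * Null maps, kernels and cokernels *)

Local Notation iso_null := (@iso_null Sup one_lattice _ _).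
Local Notation is_kernel := (@is_kernel Sup one_lattice _ _ _).
Local Notation is_cokernel := (@is_cokernel Sup one_lattice _ _ _).
Local Notation normal_mono := (@normal_mono Sup one_lattice _ _).
Local Notation normal_epi := (@normal_epi Sup one_lattice _ _).
Local Notation normal := (@normal Sup one_lattice _ _).

Section SupMaps.
Variables A B : completeLattice.

Lemma supmap_le_irr (f g : supmap A B) (p q : supmap_le f g) : p = q.
Proof. exact: Prop_irrelevance. Qed.

Lemma zero_lub (S : set A) (s : A) :
  isLub S s -> isLub ((fun=> bot : B) @` S) bot.
Proof. by move=> _; split=> [_ [x _ <-] //|t _]; exact: bot_le. Qed.

(** The constant map at the bottom element. *)
Definition zero : supmap A B := SupMap zero_lub.

Lemma isomorphicE (f g : supmap A B) : @isomorphic (suphom A B) f g <-> f = g.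
Proof.
split=> [[fg [gf _]]|->].
  by apply: supmap_eq => x; apply/le_anti; rewrite fg gf.
exists (supmap_le_refl g), (supmap_le_refl g).
by split; exact: supmap_le_irr.
Qed.

End SupMaps.

Lemma one_lattice_eq (x y : one_lattice) : x = y.
Proof. by rewrite (ord1 x) (ord1 y). Qed.

Lemma null_throughE (A B : completeLattice) (f : supmap A B) :
  @null_through Sup one_lattice A B f <-> forall x, f x = bot.
Proof.
split=> [[g [h ->]] x|f0].
  change ((h : supmap _ _) ((g : supmap _ _) x) = bot).
  by rewrite (one_lattice_eq ((g : supmap _ _) x) bot) supmap_bot.
exists (zero A one_lattice), (zero one_lattice B).
by apply: supmap_eq => x; rewrite f0.
Qed.

Lemma iso_nullE (A B : completeLattice) (f : supmap A B) :
  iso_null f <-> forall x, f x = bot.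
Proof.
split=> [[n [/null_throughE n0 /isomorphicE ->]] //|f0].
by exists f; split; [exact/null_throughE|exact/isomorphicE].
Qed.

Lemma equivalent_terminal (A B : completeLattice) :
  (forall f g : supmap A B, f = g) ->
  equivalent (suphom A B) terminal_category.
Proof.
move=> AB.
exists (fconst (suphom A B) (tt : terminal_category)).
exists (fconst terminal_category (zero A B : suphom A B)).
split; last by exists (fun=> tt); split=> [x|x y []] //; exists tt.
exists (fun (f : supmap A B) x => bot_le (f x)).
split=> [f|f g a]; last exact: supmap_le_irr.
have f0 : supmap_le f (zero A B) by move=> x; rewrite (AB f (zero A B)).
by exists f0; split; exact: supmap_le_irr.
Qed.

Lemma one_lattice_strong_bizero : @strong_bizero Sup one_lattice.
Proof.
split=> [A|A B f g /null_throughE f0 /null_throughE g0].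
  split; apply: equivalent_terminal => f g; apply: supmap_eq => x.
    exact: one_lattice_eq.
  by rewrite (one_lattice_eq x bot) !supmap_bot.
have fg : supmap_le f g by move=> x; rewrite f0 bot_le.
by exists fg; split=> // a _; exact: supmap_le_irr.
Qed.

Section Factorisation.
Variables A B C : completeLattice.

Lemma embedding_factor (k : supmap B C) (z : supmap A C) :
  (forall u v, k u <= k v -> u <= v) -> (forall x, exists u, k u = z x) ->
  exists u : supmap A B, forall x, k (u x) = z x.
Proof.
move=> k_le /choice[u uP].
have u_lub (S : set A) (s : A) : isLub S s -> isLub (u @` S) (u s).
  move=> Ss; have [ubz lez] := supmap_lub z Ss.
  split=> [_ [x Sx <-]|t tS]; apply: k_le; rewrite !uP.
    by apply: ubz; exists x.
  by apply: lez => _ [x Sx <-]; rewrite -uP; apply/supmap_mono/tS; exists x.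
by exists (SupMap u_lub).
Qed.

(** The factor is [z] along a section of [q]; it preserves suprema because the
    supremum of [S] is below the image of the supremum of its preimage. *)
Lemma surjection_factor (q : supmap A B) (z : supmap A C) :
  (forall y, exists x, q x = y) -> (forall x y, q x <= q y -> z x <= z y) ->
  exists u : supmap B C, forall x, u (q x) = z x.
Proof.
move=> /choice[r rK] q_le.
have zr x : z (r (q x)) = z x by apply/le_anti; rewrite !q_le ?rK.
have zr_lub (S : set B) (s : B) :
    isLub S s -> isLub ((z \o r) @` S) ((z \o r) s).
  move=> [ubs les]; split=> [_ [y Sy <-]|t tS] /=.
    by apply: q_le; rewrite !rK; exact: ubs.
  pose l := lub (q @^-1` S).
  apply: (@le_trans _ _ (z l)).
    apply: q_le; rewrite rK; apply: les => y Sy.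
    by rewrite -(rK y); apply/supmap_mono/le_lub; rewrite /preimage /= rK.
  have [_ +] := supmap_lub z (lubP (q @^-1` S)); apply=> _ [x Sx <-].
  by rewrite -zr; apply: tS; exists (q x).
by exists (SupMap zr_lub).
Qed.

End Factorisation.

Lemma unique_2cell (A B : completeLattice) (u v : supmap A B)
    (P : supmap_le u v -> Prop) :
  (forall mu, P mu) -> (forall x, u x <= v x) -> exists! mu, P mu.
Proof. by move=> PP uv; exists uv; split=> // mu _; exact: supmap_le_irr. Qed.

Section Kernel.
Variables (A B : completeLattice) (f : supmap A B).

Lemma order_embedding_is_kernel (K : completeLattice) (k : supmap K A) :
  (forall u v, k u <= k v -> u <= v) ->
  (forall x, f x = bot <-> exists u, k u = x) -> is_kernel f k.
Proof.
move=> k_le k_im; split.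
- by apply/iso_nullE => u; apply/k_im; exists u.
- move=> X z /iso_nullE z0.
  have [x|u uP] := embedding_factor (z := z) k_le.
    by apply/k_im; exact: z0.
  by exists u; apply/isomorphicE/supmap_eq.
- move=> X u v lam; apply: unique_2cell => [mu|x].
    exact: supmap_le_irr.
  by apply: k_le; exact: lam.
Qed.

(** The largest element killed by [f]. *)
Definition null_bound : A := lub [set x | f x = bot].

Lemma le_null_bound x : x <= null_bound <-> f x = bot.
Proof.
split=> [xn|fx0]; last exact: le_lub.
apply: le_bot; apply: le_trans (supmap_mono f xn) _.
have [_ +] := supmap_lub f (lubP [set x | f x = bot]); apply=> _ [y fy0 <-].
by rewrite fy0.
Qed.

Lemma ideal_is_kernel : is_kernel f (ideal_incl null_bound).
Proof.
apply: order_embedding_is_kernel => [u v|x]; first by rewrite ideal_incl_le.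
by rewrite -le_null_bound; exact: ideal_inclP.
Qed.

Lemma is_kernel_null (K : completeLattice) (k : supmap K A) :
  is_kernel f k -> forall u, f (k u) = bot.
Proof. by case=> /iso_nullE. Qed.

Lemma is_kernel_lift (K X : completeLattice) (k : supmap K A)
    (z : supmap X A) :
  is_kernel f k -> (forall x, f (z x) = bot) ->
  exists u : supmap X K, forall x, k (u x) = z x.
Proof.
move=> [_ lift _] z0.
have [u /isomorphicE uz] := lift X z (iffRL (iso_nullE (supcomp f z)) z0).
by exists u => x; rewrite -uz.
Qed.

Lemma is_kernel_full (K X : completeLattice) (k : supmap K A)
    (u v : supmap X K) :
  is_kernel f k -> (forall x, k (u x) <= k (v x)) -> forall x, u x <= v x.
Proof. by move=> [_ _ full] kuv; have [] := full X u v kuv. Qed.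

(** The forward direction compares [k] with the ideal inclusion: the two factor
    through each other, and the composite on [K] is the identity by full
    faithfulness of [k]. *)
Lemma is_kernelP (K : completeLattice) (k : supmap K A) :
  is_kernel f k <->
  (forall u v, k u <= k v -> u <= v) /\
  (forall x, f x = bot <-> exists u, k u = x).
Proof.
split=> [kK|[]]; last exact: order_embedding_is_kernel.
have [u iu] := is_kernel_lift ideal_is_kernel (is_kernel_null kK).
have [v kv] := is_kernel_lift kK (is_kernel_null ideal_is_kernel).
have le_vu : forall x, supid K x <= supcomp v u x.
  by apply: (is_kernel_full kK) => x /=; rewrite kv iu.
have vu_le : forall x, supcomp v u x <= supid K x.
  by apply: (is_kernel_full kK) => x /=; rewrite kv iu.
split=> [x y|x].
  rewrite -!iu ideal_incl_le => /(supmap_mono v) vxy.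
  exact: le_trans (le_vu x) (le_trans vxy (vu_le y)).
split=> [/le_null_bound/ideal_inclP[w <-]|[w <-]].
  by exists (v w).
exact: is_kernel_null kK w.
Qed.

End Kernel.

Section Cokernel.
Variables (A B : completeLattice) (f : supmap A B).

Lemma surjection_is_cokernel (Q : completeLattice) (q : supmap B Q) :
  (forall y, exists x, q x = y) ->
  (forall x y, q x <= q y <-> x <= join y (f top)) -> is_cokernel f q.
Proof.
move=> q_surj qE; split.
- apply/iso_nullE => x; apply: le_bot; rewrite -[leRHS](supmap_bot q).
  by apply/qE; apply: le_trans (le_joinr _ _); apply/supmap_mono/le_top.
- move=> X z /iso_nullE z0.
  have [x y /qE xy|u uP] := surjection_factor (z := z) q_surj.
    apply: le_trans (supmap_mono (z : supmap _ _) xy) _.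
    by rewrite supmap_join [X in join _ X](z0 top) join_bot.
  by exists u; apply/isomorphicE/supmap_eq.
- move=> X u v lam; apply: unique_2cell => [mu|y].
    exact: supmap_le_irr.
  by have [x <-] := q_surj y; exact: lam.
Qed.

Lemma filter_is_cokernel : is_cokernel f (filter_proj (f top)).
Proof.
apply: surjection_is_cokernel => [|x y]; first exact: filter_proj_surj.
by rewrite filter_proj_le.
Qed.

Lemma is_cokernel_null (Q : completeLattice) (q : supmap B Q) :
  is_cokernel f q -> forall x, q (f x) = bot.
Proof. by case=> /iso_nullE. Qed.

Lemma is_cokernel_extend (Q X : completeLattice) (q : supmap B Q)
    (z : supmap B X) :
  is_cokernel f q -> (forall x, z (f x) = bot) ->
  exists u : supmap Q X, forall x, u (q x) = z x.
Proof.
move=> [_ ext _] z0.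
have [u /isomorphicE uz] := ext X z (iffRL (iso_nullE (supcomp z f)) z0).
by exists u => x; rewrite -uz.
Qed.

Lemma is_cokernel_full (Q X : completeLattice) (q : supmap B Q)
    (u v : supmap Q X) :
  is_cokernel f q -> (forall x, u (q x) <= v (q x)) -> forall y, u y <= v y.
Proof. by move=> [_ _ full] uvq; have [] := full X u v uvq. Qed.

(** As for kernels, by comparison with the projection onto the filter. *)
Lemma is_cokernelP (Q : completeLattice) (q : supmap B Q) :
  is_cokernel f q <->
  (forall y, exists x, q x = y) /\
  (forall x y, q x <= q y <-> x <= join y (f top)).
Proof.
split=> [qQ|[]]; last exact: surjection_is_cokernel.
have [u uq] := is_cokernel_extend qQ (is_cokernel_null filter_is_cokernel).
have [v vp] := is_cokernel_extend filter_is_cokernel (is_cokernel_null qQ).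
have le_vu : forall y, supid Q y <= supcomp v u y.
  by apply: (is_cokernel_full qQ) => x /=; rewrite uq vp.
have vu_le : forall y, supcomp v u y <= supid Q y.
  by apply: (is_cokernel_full qQ) => x /=; rewrite uq vp.
split=> [y|x y].
  have [x xE] := filter_proj_surj (u y).
  exists x; rewrite -vp xE; apply/le_anti/andP.
  by split; [exact: vu_le|exact: le_vu].
rewrite -filter_proj_le -!uq; split; first exact: supmap_mono.
move=> /(supmap_mono v) vxy.
exact: le_trans (le_vu _) (le_trans vxy (vu_le _)).
Qed.

End Cokernel.

Lemma ideal_incl_top (A : completeLattice) (a : A) : ideal_incl a top = a.
Proof.
have [u ua] := (ideal_inclP a a).1 (lexx a).
apply/le_anti/andP; split; first by apply/ideal_inclP; exists top.
by rewrite -{1}ua; exact/supmap_mono/le_top.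
Qed.

Lemma ideal_filter_is_kernel (A : completeLattice) (a : A) :
  is_kernel (filter_proj a) (ideal_incl a).
Proof.
apply/is_kernelP; split=> [u v|x]; first by rewrite ideal_incl_le.
rewrite -ideal_inclP -(supmap_bot (filter_proj a)).
rewrite -[in X in _ <-> X](bot_join a) -filter_proj_le.
split=> [->|xa]; first exact: lexx.
by apply/le_anti; rewrite xa; exact/supmap_mono/bot_le.
Qed.

Lemma ideal_filter_is_cokernel (A : completeLattice) (a : A) :
  is_cokernel (ideal_incl a) (filter_proj a).
Proof.
by have := filter_is_cokernel (ideal_incl a); rewrite ideal_incl_top.
Qed.

Lemma ideal_incl_normal_mono (A : completeLattice) (a : A) :
  normal_mono (ideal_incl a).
Proof.
by exists (filter a), (filter_proj a); exact: ideal_filter_is_kernel.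
Qed.

Lemma filter_proj_normal_epi (A : completeLattice) (a : A) :
  normal_epi (filter_proj a).
Proof.
by exists (ideal a), (ideal_incl a); exact: ideal_filter_is_cokernel.
Qed.

Lemma Sup_z_exact : @z_exact Sup one_lattice.
Proof.
split=> [|A B f|A B f]; first exact: one_lattice_strong_bizero.
  by exists (ideal (null_bound f)), (ideal_incl _); exact: ideal_is_kernel.
exists (filter ((f : supmap A B) top)), (filter_proj _).
exact: filter_is_cokernel.
Qed.

(** * Normal maps *)

Lemma normal_monoP (K A : completeLattice) (m : supmap K A) :
  normal_mono m <->
  (forall u v, m u <= m v -> u <= v) /\
  (forall x u, x <= m u -> exists v, m v = x).
Proof.
split=> [[B [f /is_kernelP[m_le m_im]]]|[m_le m_down]].
  split=> // x u xu; apply/m_im/le_bot.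
  apply: le_trans (supmap_mono (f : supmap _ _) xu) _.
  by rewrite [leLHS](iffRL (m_im (m u))) //; exists u.
exists (filter (m top)), (filter_proj (m top)); apply/is_kernelP; split=> // x.
rewrite -(supmap_bot (filter_proj (m top))); split=> [x0|[u <-]].
  apply: (m_down x top); rewrite -[leRHS]bot_join -filter_proj_le x0.
  exact: lexx.
apply/le_anti; rewrite !filter_proj_le bot_le bot_join andbT.
exact/supmap_mono/le_top.
Qed.

Lemma normal_epiP (B Q : completeLattice) (e : supmap B Q) :
  normal_epi e <->
  (forall y, exists x, e x = y) /\
  (exists b, forall x y, e x <= e y <-> x <= join y b).
Proof.
split=> [[A [f /is_cokernelP[e_surj eE]]]|[e_surj [b eE]]].
  by split=> //; exists ((f : supmap _ _) top).
exists (ideal b), (ideal_incl b); apply/is_cokernelP; split=> // x y.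
by rewrite ideal_incl_top.
Qed.

Lemma normalP (A B : completeLattice) (f : supmap A B) :
  normal f <->
  (forall x u, x <= f u -> exists v, f v = x) /\
  (exists a, forall x y, f x <= f y <-> x <= join y a).
Proof.
split=> [[I [e [m [/normal_epiP[e_surj [a eE]] /normal_monoP[m_le m_down]]]]]|].
  move=> /isomorphicE ->; split=> [x u /m_down[i <-]|].
    by have [v ve] := e_surj i; exists v; rewrite -ve.
  exists a => x y; rewrite -eE.
  by split=> [/m_le|/(supmap_mono (m : supmap _ _))].
(* The middle object is the ideal below [f top], which is the image of [f]. *)
move=> [f_down [a fE]].
have fm x : exists i, ideal_incl (f top) i = f x.
  by apply/ideal_inclP/supmap_mono/le_top.
have i_le (u v : ideal (f top)) : ideal_incl _ u <= ideal_incl _ v -> u <= v.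
  by rewrite ideal_incl_le.
have [e eP] := embedding_factor i_le fm.
exists (ideal (f top)), e, (ideal_incl _); split.
- apply/normal_epiP; split=> [y|]; last first.
    by exists a => x y; rewrite -fE -ideal_incl_le !eP.
  have [v fv] : exists v, f v = ideal_incl _ y.
    by apply: (f_down _ top); apply/ideal_inclP; exists y.
  by exists v; apply/le_anti; rewrite -!ideal_incl_le eP fv lexx.
- apply/normal_monoP; split=> // x u xu; apply/ideal_inclP.
  by apply: le_trans xu _; apply/ideal_inclP; exists u.
- by apply/isomorphicE/supmap_eq => x; rewrite -eP.
Qed.

Lemma Sup_normal_monos_closed : @normal_monos_closed Sup one_lattice.
Proof.
move=> A B C m n /normal_monoP[m_le m_down] /normal_monoP[n_le n_down].
apply/normal_monoP; split=> [u v /n_le/m_le //|x u xu].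
have [y yx] := n_down _ _ xu; rewrite -yx in xu *.
by have [v <-] := m_down _ _ (n_le _ _ xu); exists v.
Qed.

Lemma Sup_normal_epis_closed : @normal_epis_closed Sup one_lattice.
Proof.
move=> A B C e p /normal_epiP[e_surj [a eE]] /normal_epiP[p_surj [b pE]].
apply/normal_epiP; split=> [z|].
  by have [y <-] := p_surj z; have [x <-] := e_surj y; exists x.
have [b' eb'] := e_surj b.
exists (join b' a) => x y; rewrite joinA -eE supmap_join eb'; exact: pE.
Qed.

Lemma Sup_homologically_self_dual : homologically_self_dual Sup one_lattice.
Proof.
split=> [|K X R m e _ em0 M Q d]; first exact: Sup_z_exact.
move=> [k [c [kK /is_cokernelP[c_surj cE] ->]]].
have /normal_monoP[k_le k_down] : normal_mono k by exists R, e.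
have [_ k_im] := (is_kernelP e k).1 kK.
have [a ka] := (k_im _).1 ((iso_nullE (supcomp e m)).1 em0 top).
have cK x y : (c : supmap X Q) x <= (c : supmap X Q) ((k : supmap M X) y) <->
    x <= (k : supmap M X) (join y a).
  by rewrite cE supmap_join ka.
apply/(normalP (supcomp c k)); split=> [x u|].
  by have [w <-] := c_surj x; rewrite cK => /k_down[v <-]; exists v.
exists a => x y; rewrite /= cK.
by split=> [/k_le|/(supmap_mono (k : supmap M X))].
Qed.

(** * The pentagon *)

(** The five-element non-modular lattice: [PLow < PHigh], and [PSide] is a
    complement of both. *)
Inductive pentagon := PBot | PLow | PHigh | PSide | PTop.

Definition pentagon_code (x : pentagon) : nat :=
  match x with PBot => 0 | PLow => 1 | PHigh => 2 | PSide => 3 | PTop => 4 end.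
Definition pentagon_decode (n : nat) : pentagon :=
  nth PTop [:: PBot; PLow; PHigh; PSide] n.
Lemma pentagon_codeK : cancel pentagon_code pentagon_decode.
Proof. by case. Qed.
HB.instance Definition _ := Countable.copy pentagon (can_type pentagon_codeK).

Definition pentagon_le (x y : pentagon) : bool :=
  match x, y with
  | PBot, _ | _, PTop | PLow, (PLow | PHigh)
  | PHigh, PHigh | PSide, PSide => true
  | _, _ => false
  end.

Lemma pentagon_le_refl : reflexive pentagon_le. Proof. by case. Qed.
Lemma pentagon_le_anti : antisymmetric pentagon_le. Proof. by do 2!case. Qed.
Lemma pentagon_le_trans : transitive pentagon_le. Proof. by do 3!case. Qed.
HB.instance Definition _ := Order.Le_isPOrder.Build (Order.Disp tt tt)
  pentagon pentagon_le_refl pentagon_le_anti pentagon_le_trans.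

Definition pentagon_join (x y : pentagon) : pentagon :=
  if x <= y then y else if y <= x then x else PTop.

Lemma pentagon_join_le (x y z : pentagon) :
  (pentagon_join x y <= z) = (x <= z) && (y <= z).
Proof. by case: x; case: y; case: z. Qed.

(** Finite joins suffice; the induction runs over an enumeration of the
    elements, joining those that belong to [S]. *)
Lemma pentagon_complete (S : set pentagon) : exists s, isLub S s.
Proof.
suff [s sP] : exists s, forall y, s <= y <-> forall x,
    x \in [:: PBot; PLow; PHigh; PSide; PTop] -> S x -> x <= y.
  exists s; split=> [x Sx|y Sy]; last by apply/sP => x _; exact: Sy.
  by apply: (sP s).1 Sx => //; case: x.
elim: [:: _; _; _; _; _] => [|x r [s sP]].
  by exists PBot => y; split=> //; case: y.
have [Sx|Sx] := pselect (S x); last first.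
  exists s => y; rewrite sP; split=> le_y z; last first.
    by move=> zr; apply: le_y; rewrite in_cons zr orbT.
  by rewrite in_cons => /predU1P[->|] //; exact: le_y.
exists (pentagon_join x s) => y; rewrite pentagon_join_le; split.
  move=> /andP[xy /sP le_y] z.
  by rewrite in_cons => /predU1P[->|] //; exact: le_y.
move=> le_y; rewrite le_y ?mem_head //=; apply/sP => z zr.
by apply: le_y; rewrite in_cons zr orbT.
Qed.

Definition pentagon_lattice : completeLattice :=
  CompleteLattice pentagon_complete.

Lemma pentagon_joinE (x y : pentagon_lattice) : join x y = pentagon_join x y.
Proof.
apply/le_anti/andP; split.
  rewrite join_le; have := lexx (pentagon_join x y).
  by rewrite pentagon_join_le.
have : (pentagon_join x y : pentagon) <= join x y; last by [].
rewrite pentagon_join_le; apply/andP.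
by split; [exact: (le_joinl x y)|exact: (le_joinr x y)].
Qed.

Lemma pentagon_bot : bot = PBot :> pentagon_lattice.
Proof. by apply/esym/le_bot. Qed.

Lemma not_DPN : ~ DPN Sup one_lattice.
Proof.
pose low : pentagon_lattice := PLow.
pose high : pentagon_lattice := PHigh.
pose side : pentagon_lattice := PSide.
pose m := ideal_incl high; pose e := filter_proj side.
pose k := ideal_incl side; pose c := filter_proj high.
have c_le x y : (c x <= c y) = (x <= join y high) by exact: filter_proj_le.
have e_le x y : (e x <= e y) = (x <= join y side) by exact: filter_proj_le.
have me_normal : normal_mono m /\ normal_epi e.
  by split; [exact: ideal_incl_normal_mono|exact: filter_proj_normal_epi].
have d_normal : normal (supcomp c k).
  have kP x : k x = PBot \/ k x = PSide.
    have : k x <= side by apply/ideal_inclP; exists x.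
    by case: (k x) => // _; [left|right].
  apply/normalP; split=> [y u _|].
    have [x <-] := filter_proj_surj y.
    (* The dinversion is onto: [c] takes only the values it has at [PBot] and
       at [side]. *)
    have [w w_side cw] : exists2 w, w <= side & c w = c x.
      exists (if (x : pentagon_lattice) <= high then PBot else PSide).
        by case: ifP.
      apply/le_anti; rewrite !c_le !pentagon_joinE.
      by case: (x).
    have [v vw] := (ideal_inclP side w).1 w_side.
    by exists v; rewrite -cw -vw.
  exists bot => x y; rewrite join_bot -(ideal_incl_le x y) -/k.
  change (c (k x) <= c (k y) <-> k x <= k y); rewrite c_le pentagon_joinE.
  by case: (kP x) => ->; case: (kP y) => ->.
move=> /(_ _ _ _ m e me_normal _ _ _ (ex_intro _ k (ex_intro _ c
  (And3 (ideal_filter_is_kernel _) (ideal_filter_is_cokernel _) erefl)))).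
case=> _ /(_ d_normal) /(normalP (supcomp e m)) [_ [a aP]].
(* If the composite were normal, the element [a] measuring its congruence would
   be killed by [e], hence lie below both [high] and [side], so be the bottom;
   but [e] identifies [low] with [high]. *)
have [l lE] : exists l, m l = low by exact/ideal_inclP.
have [h hE] : exists h, m h = high by exact/ideal_inclP.
have a_high : m a <= high by apply/ideal_inclP; exists a.
have a_side : m a <= side.
  have : e (m a) <= e (m bot) by apply/(aP a bot).2/le_joinr.
  by rewrite e_le (supmap_bot m) bot_join.
have a_bot : m a = bot.
  by rewrite pentagon_bot; move: a_high a_side; case: (m a).
have /(aP h l).1 : e (m h) <= e (m l) by rewrite e_le hE lE pentagon_joinE.
by rewrite -(ideal_incl_le h (join l a)) -/m supmap_join hE lE a_bot join_bot.
Qed.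

Theorem proposition8p38 :
  homologically_self_dual Sup one_lattice /\
  normal_monos_closed Sup one_lattice /\
  normal_epis_closed Sup one_lattice /\
  ~ DPN Sup one_lattice.
Proof.
split; first exact: Sup_homologically_self_dual.
split; first exact: Sup_normal_monos_closed.
split; first exact: Sup_normal_epis_closed.
exact: not_DPN.
Qed.
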